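(* Let $S=(V,E^+\cup E^-)$ be a finite complete signed graph. Then $S$ has a valid distance drawing in some real tree if and only if its positive subgraph $S^+=(V,E^+)$ is an NSI graph, i.e., $S^+$ is the intersection graph of a family of balls in some real tree.
   Context: A signed graph $S=(V,E^+\cup E^-)$ is a simple graph whose edge set is partitioned into positive edges $E^+$ and negative edges $E^-$ ($E^+\cap E^-=\emptyset$); it is complete if every pair of distinct vertices is joined by an edge (positive or negative). Its positive subgraph is $S^+=(V,E^+)$. A real tree ($\mathbb{R}$-tree) is a metric space $(\mathcal{T},d)$ such that any two points $x,y$ are joined by a unique topological arc, and this arc is a geodesic segment of length $d(x,y)$. A valid distance drawing of $S$ in a metric space $(\mathcal{T},d)$ is an injective map $D:V\to\mathcal{T}$ such that for every vertex $u$ and every pair of edges $\{u,v\}\in E^+$, $\{u,w\}\in E^-$, we have $d(D(u),D(v))<d(D(u),D(w))$. The ball centered at $x$ with radius $r$ is $B(x,r)=\{y\in\mathcal{T}: d(x,y)\le r\}$. The intersection graph of a family $\{B_v\}_{v\in V}$ of sets has vertex set $V$, with distinct $u,v$ adjacent iff $B_u\cap B_v\neq\emptyset$. *)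

(* Defs.v *)
From HB Require Import structures.
From mathcomp Require Import all_boot all_order all_algebra.
From mathcomp Require Import boolp classical_sets set_interval reals topology.

Set Implicit Arguments.
Unset Strict Implicit.
Unset Printing Implicit Defensive.

Import Order.TTheory GRing.Theory Num.Theory.
Import numFieldTopology.Exports.

Local Open Scope classical_set_scope.
Local Open Scope ring_scope.

Record simple_graph (V : finType) := SimpleGraph {
  adj : rel V;
  adj_sym : symmetric adj;
  adj_irr : irreflexive adj
}.

Record signed_graph (V : finType) := SignedGraph {
  pos : rel V;
  neg : rel V;
  pos_sym : symmetric pos;
  neg_sym : symmetric neg;
  pos_irr : irreflexive pos;
  neg_irr : irreflexive neg;
  pos_neg_disjoint : forall u v, ~~ (pos u v && neg u v)
}.

Definition complete_signed (V : finType) (S : signed_graph V) : Prop :=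
  forall u v : V, u != v -> pos S u v || neg S u v.

Definition positive_subgraph (V : finType) (S : signed_graph V) :
    simple_graph V :=
  SimpleGraph (@pos_sym V S) (@pos_irr V S).

(* An injective path on the compact interval [0, 1] into a (Hausdorff) metric
   space is a homeomorphism onto its image, so these are the topological arcs.
   There is none from a point to itself. *)
Definition is_arc (R : realType) (T : metricType R) (x y : T) (A : set T) :
    Prop :=
  exists f : R -> T,
    [/\ {within `[0, 1], continuous f},
        {in `[0, 1] &, injective f},
        f 0 = x, f 1 = y
      & A = f @` `[0, 1]].

(* The length of the segment is mdist x y. *)
Definition is_geodesic_segment (R : realType) (T : metricType R) (x y : T)
    (A : set T) : Prop :=
  exists g : R -> T,
    [/\ {in `[0, mdist x y] &,
          forall s t : R, mdist (g s) (g t) = `|s - t|},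
        g 0 = x, g (mdist x y) = y
      & A = g @` `[0, mdist x y]].

(* For x = y the condition is void: the degenerate arc is {x}. *)
Definition real_tree (R : realType) (T : metricType R) : Prop :=
  forall x y : T, x != y ->
    exists A : set T,
      [/\ is_arc x y A,
          forall B : set T, is_arc x y B -> B = A
        & is_geodesic_segment x y A].

Definition valid_distance_drawing (R : realType) (V : finType)
    (S : signed_graph V) (T : metricType R) (D : V -> T) : Prop :=
  injective D /\
  forall u v w : V, pos S u v -> neg S u w ->
    mdist (D u) (D v) < mdist (D u) (D w).

(* Not the library's closed_ball, which is the closure of the open ball and is
   empty for r = 0. *)
Definition cball (R : realType) (T : metricType R) (x : T) (r : R) : set T :=
  [set y | mdist x y <= r].

Definition is_intersection_graph (V : finType) (T : Type)
    (G : simple_graph V) (B : V -> set T) : Prop :=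
  forall u v : V, u != v -> (adj G u v <-> B u `&` B v !=set0).

Definition NSI_graph (R : realType) (V : finType) (G : simple_graph V) :
    Prop :=
  exists T : metricType R, real_tree T /\
    exists (c : V -> T) (r : V -> R),
      (forall v, 0 <= r v) /\
      is_intersection_graph G (fun v => cball (c v) (r v)).

(* Main.v *)
(* If D is a valid drawing and r_u is half the largest distance from D(u) to a
   positive neighbour of u, then d(D(u), D(v)) is at most both 2 r_u and 2 r_v
   when uv is positive and larger than both when uv is negative, so the balls
   B(D(u), r_u) represent the positive subgraph in the same tree.

   Conversely, given balls B(c_v, r_v), attach to the tree at c_v a segment of
   length M - r_v, with M large, and let D(v) be its free end: every positive
   distance is then at most 2M and every negative one larger. The tree with a
   half-line attached at each of its points is again a real tree: any path
   leaving a half-line goes through its foot, so by injectivity an arc cannot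
   enter a half-line containing none of its endpoints, and its part between
   the feet of its endpoints lies in the original tree. *)

From HB Require Import structures.
Require Import Defs.
From mathcomp Require Import all_boot all_order all_algebra.
From mathcomp Require Import boolp classical_sets set_interval reals topology.
From mathcomp Require Import normedtype lra.

Set Implicit Arguments.
Unset Strict Implicit.
Unset Printing Implicit Defensive.

Import Order.TTheory GRing.Theory Num.Theory.
Import numFieldTopology.Exports.

Local Open Scope classical_set_scope.
Local Open Scope ring_scope.

(** * Paths, arcs and geodesics in metric spaces and real trees *)

Section paths.
Variable R : realType.
Implicit Types T U : metricType R.

Lemma within_continuous_mdistP T (A : set R) (f : R -> T) :
  {within A, continuous f} <->
  forall x, A x -> forall e, 0 < e ->
    exists2 d, 0 < d & forall y, A y -> `|x - y| < d -> mdist (f x) (f y) < e.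
Proof.
split=> [/subspace_continuousP cf x Ax e e0|cf].
  have := cf x Ax.
  move/metricType_numDomainType.cvgrPdist_lt => /(_ _ e0).
  rewrite near_withinE near_simpl => /nbhs_ballP[d /= d0 dP].
  by exists d => // y Ay xy; apply: dP.
apply/subspace_continuousP => x Ax.
apply/metricType_numDomainType.cvgrPdist_lt => e /(cf x Ax)[d d0 dP].
rewrite near_withinE; apply/nbhs_ballP; exists d => //= y xy Ay.
exact: dP.
Qed.

Lemma within_continuous_nonexpansive T U (A : set R) (f : R -> T) (F : T -> U) :
  (forall a b, mdist (F a) (F b) <= mdist a b) ->
  {within A, continuous f} -> {within A, continuous (F \o f)}.
Proof.
move=> F1 /within_continuous_mdistP cf; apply/within_continuous_mdistP.
move=> x Ax e /(cf x Ax)[d d0 dP]; exists d => // y Ay xy.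
exact: le_lt_trans (F1 _ _) (dP _ Ay xy).
Qed.

(** Meant for [mdist x] and [signed_height x], whose levels locate points of a path. *)
Lemma path_IVT T (F : T -> R) (f : R -> T) (a b v : R) :
  (forall p q, `|F p - F q| <= mdist p q) ->
  {within `[0, 1], continuous f} -> 0 <= a -> a <= b -> b <= 1 ->
  Num.min (F (f a)) (F (f b)) <= v <= Num.max (F (f a)) (F (f b)) ->
  exists c, [/\ a <= c, c <= b & F (f c) = v].
Proof.
move=> F1 cf a0 ab b1 vP.
have cF : {within `[0, 1], continuous (F \o f)}.
  apply: (@within_continuous_nonexpansive T R^o) cf => p q.
  by rewrite /mdist/= distrC.
have [|c] := @IVT R (F \o f) a b v ab _ vP.
  apply: continuous_subspaceW cF => x /=; rewrite !in_itv/= => /andP[? ?]; lra.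
by rewrite in_itv/= => /andP[? ?] <-; exists c.
Qed.

Definition arc_path T (x y : T) (f : R -> T) :=
  [/\ {within `[0, 1], continuous f}, {in `[0, 1] &, injective f},
      f 0 = x & f 1 = y].

Definition geodesic_path T (x y : T) (g : R -> T) :=
  [/\ {in `[0, mdist x y] &, forall s t : R, mdist (g s) (g t) = `|s - t|},
      g 0 = x & g (mdist x y) = y].

Lemma geodesic_arc_path T (x y : T) (g : R -> T) : x != y ->
  geodesic_path x y g -> arc_path x y (fun t => g (t * mdist x y)).
Proof.
move=> xy [iso g0 g1]; have d0 : 0 < mdist x y by rewrite mdist_gt0.
have in01 t : 0 <= t -> t <= 1 -> t * mdist x y \in `[0, mdist x y].
  move=> t0 t1; rewrite in_itv/= mulr_ge0 ?(ltW d0)//=.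
  by rewrite ler_piMl // ltW.
split; rewrite ?mul0r ?mul1r//.
- apply/within_continuous_mdistP => s /=; rewrite in_itv/= => /andP[s0 s1] e e0.
  exists (e / mdist x y); first by rewrite divr_gt0.
  move=> t; rewrite in_itv/= => /andP[t0 t1].
  by rewrite ltr_pdivlMr// iso ?in01// -mulrBl normrM (gtr0_norm d0).
- move=> s t; rewrite !in_itv/= => /andP[s0 s1] /andP[t0 t1] st.
  have := iso _ _ (in01 _ s0 s1) (in01 _ t0 t1).
  rewrite st mdistxx => /esym/normr0_eq0/subr0_eq.
  by apply: mulIf; rewrite gt_eqF.
Qed.

Lemma sub_arc_path T (f : R -> T) (a b : R) : 0 <= a -> a < b -> b <= 1 ->
  {within `[a, b], continuous f} -> {in `[a, b] &, injective f} ->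
  arc_path (f a) (f b) (fun t => f (a + t * (b - a))).
Proof.
move=> a0 ab b1 /within_continuous_mdistP cf fI.
have ba : 0 < b - a by rewrite subr_gt0.
have inab t : t \in `[0, 1] -> a + t * (b - a) \in `[a, b].
  rewrite !in_itv/= => /andP[t0 t1]; apply/andP; split; nra.
split.
- apply/within_continuous_mdistP => s s01 e e0.
  have [d d0 dP] := cf _ (inab _ s01) _ e0.
  exists (d / (b - a)); first by rewrite divr_gt0.
  move=> t t01; rewrite ltr_pdivlMr// => st; apply: dP; first exact: inab.
  rewrite (_ : _ - _ = (s - t) * (b - a)); last by lra.
  by rewrite normrM (gtr0_norm ba).
- move=> s t s01 t01 /(fI _ _ (inab _ s01) (inab _ t01)) /addrI.
  by apply: mulIf; rewrite gt_eqF.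
- by rewrite mul0r addr0.
- by congr (f _); lra.
Qed.

Lemma mdist_nonexpansive T (x p q : T) :
  `|mdist x p - mdist x q| <= mdist p q.
Proof.
have := metric_triangle x p q; have := metric_triangle x q p.
by rewrite (metric_sym q p) ler_norml => ? ?; apply/andP; split; lra.
Qed.

(* The reverse inclusion between the images, needed for [real_tree], follows
   from the intermediate value theorem for [mdist x]. *)
Lemma real_treeP T : real_tree T <->
  forall x y : T, x != y -> exists2 g, geodesic_path x y g &
    forall f, arc_path x y f -> f @` `[0, 1] `<=` g @` `[0, mdist x y].
Proof.
split=> [TT x y /TT[A [_ uA [g [iso g0 g1 AE]]]]|TT x y xy].
  exists g => // f [cf fI f0 f1]; rewrite -AE => z fz.
  by rewrite -(uA (f @` `[0, 1])) //; exists f.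
have [g gP gM] := TT x y xy; have [iso g0 g1] := gP.
have d0 : 0 < mdist x y by rewrite mdist_gt0.
exists (g @` `[0, mdist x y]); split; last by exists g.
- have [cg gI e0 e1] := geodesic_arc_path xy gP.
  exists (fun t => g (t * mdist x y)); split => //; apply/seteqP; split => z /=.
    move=> [t]; rewrite in_itv/= => /andP[t0 t1] <-.
    exists (t / mdist x y); last by rewrite divfK// gt_eqF.
    by rewrite in_itv/= divr_ge0 ?(ltW d0)//= ler_pdivrMr// mul1r.
  move=> [t]; rewrite in_itv/= => /andP[t0 t1] <-.
  exists (t * mdist x y) => //.
  by rewrite in_itv/= mulr_ge0 ?(ltW d0)//= ler_piMl// ltW.
- move=> B [f [cf fI f0 f1 ->]]; have fP : arc_path x y f by [].
  apply/seteqP; split; first exact: gM.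
  move=> z [r]; rewrite /= in_itv/= => /andP[r0 rd] <-.
  (* Some [f c] lies at distance [r] from [x]. By [gM] it is a point [g r'], and since [g] is
     isometric and starts at [x], [r' = r]. *)
  have [|c [c0 c1 cr]] := path_IVT (v := r) (@mdist_nonexpansive T x) cf
    (lexx 0) ler01 (lexx 1).
    by rewrite f0 f1 mdistxx min_l ?max_r ?(ltW d0)// r0.
  exists c; first by rewrite /= in_itv/= c0.
  have [|r' /=] := gM _ fP (f c); first by exists c => //=; rewrite in_itv/= c0.
  rewrite in_itv/= => /andP[r'0 r'd] fc; rewrite -fc; congr g.
  rewrite -cr -fc -g0 iso ?in_itv/= ?lexx ?r'0 ?r'd ?(ltW d0)//=.
  by rewrite sub0r normrN ger0_norm.
Qed.

(** For the converse, the common point is the one at distance [r] from [x] on the geodesic to [y],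
    or [y] itself when [r] exceeds the distance. *)
Lemma cball_meetP T (x y : T) (r s : R) : real_tree T -> 0 <= r -> 0 <= s ->
  cball x r `&` cball y s !=set0 <-> mdist x y <= r + s.
Proof.
move=> TT r0 s0; split=> [[z []]|].
  rewrite /cball/= => xz yz.
  have := metric_triangle x z y; rewrite (metric_sym z y); lra.
have [->|xy] := eqVneq x y; first by exists y; split; rewrite /= /cball/= mdistxx.
have /real_treeP/(_ x y xy)[g [iso g0 g1] _] := TT.
have d0 : 0 < mdist x y by rewrite mdist_gt0.
move=> drs; have [rd|dr] := leP r (mdist x y); last first.
  by exists y; split; rewrite /cball/= ?mdistxx// ltW.
exists (g r); split; rewrite /cball/=.
  rewrite -[X in mdist X]g0 iso ?in_itv/= ?lexx ?r0 ?rd ?(ltW d0)//=.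
  by rewrite sub0r normrN ger0_norm.
rewrite -[X in mdist X]g1 iso ?in_itv/= ?lexx ?r0 ?rd ?(ltW d0)//=.
by rewrite ger0_norm ?subr_ge0//; lra.
Qed.

End paths.

(** * The comb: a half-line, or tooth, attached at each point of a metric space *)

Definition comb (R : realType) (T : metricType R) := {p : T * R | 0 <= p.2}.

Section comb_metric.
Variables (R : realType) (T : metricType R).

HB.instance Definition _ := Choice.on (comb T).

Definition foot (a : comb T) : T := (val a).1.
Definition height (a : comb T) : R := (val a).2.

Lemma height_ge0 (a : comb T) : 0 <= height a.
Proof. exact: (valP a). Qed.

Lemma combP (a b : comb T) : foot a = foot b -> height a = height b -> a = b.
Proof.
move=> f h; apply: val_inj.
by rewrite (surjective_pairing (val a)) (surjective_pairing (val b)); congr pair.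
Qed.

(** Distinct teeth communicate only through their feet: the way leads down one tooth, across the
    base and up the other. *)
Definition comb_dist (a b : comb T) : R :=
  if foot a == foot b then `|height a - height b|
  else height a + mdist (foot a) (foot b) + height b.

Lemma comb_distxx a : comb_dist a a = 0.
Proof. by rewrite /comb_dist eqxx subrr normr0. Qed.

Lemma comb_dist_positivity a b : comb_dist a b = 0 -> a = b.
Proof.
rewrite /comb_dist; have [fab|fab] := eqVneq.
  by move=> /normr0_eq0/subr0_eq; apply: combP.
have := height_ge0 a; have := height_ge0 b.
move: fab; rewrite -mdist_gt0 => *; exfalso; lra.
Qed.

Lemma comb_dist_sym a b : comb_dist a b = comb_dist b a.
Proof.
rewrite /comb_dist eq_sym distrC metric_sym; case: ifP => // _.
by rewrite addrAC [RHS]addrAC (addrC (height a)).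
Qed.

Lemma comb_dist_triangle b a c : comb_dist a c <= comb_dist a b + comb_dist b c.
Proof.
have a0 := height_ge0 a; have b0 := height_ge0 b; have c0 := height_ge0 c.
have tri := metric_triangle (foot a) (foot b) (foot c).
have nab := ler_norm (height a - height b).
have nba := ler_norm (height b - height a); rewrite distrC in nba.
have ncb := ler_norm (height c - height b); rewrite distrC in ncb.
have nbc := ler_norm (height b - height c).
have dab := mdist_ge0 (foot a) (foot b); have dbc := mdist_ge0 (foot b) (foot c).
rewrite /comb_dist; case: (eqVneq (foot a) (foot b)) tri dab => [->|ab] tri dab.
  case: (eqVneq (foot b) (foot c)) tri dbc => [->|bc] tri dbc.
    exact: ler_distD.
  by lra.
case: (eqVneq (foot b) (foot c)) ab tri dbc => [<-|bc] ab tri dbc.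
  rewrite (negPf ab); lra.
by case: eqP => _; rewrite ?ler_norml; try (apply/andP; split); lra.
Qed.

HB.instance Definition _ := isMetric.Build R (comb T) comb_distxx
  comb_dist_positivity comb_dist_sym comb_dist_triangle.

Lemma comb_mdistE (a b : comb T) : mdist a b =
  if foot a == foot b then `|height a - height b|
  else height a + mdist (foot a) (foot b) + height b.
Proof. by []. Qed.

Fact tooth_subproof (x : T) (s : R) : 0 <= (x, Num.max 0 s).2.
Proof. by rewrite /= le_max lexx. Qed.

(* The height is truncated to be nonnegative, to make [tooth] total. *)
Definition tooth (x : T) (s : R) : comb T :=
  exist (fun p : T * R => 0 <= p.2) _ (tooth_subproof x s).

Lemma height_tooth x s : 0 <= s -> height (tooth x s) = s.
Proof. by move=> s0; rewrite /height/= max_r. Qed.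

Lemma toothE (a : comb T) : tooth (foot a) (height a) = a.
Proof. by apply: combP; rewrite ?height_tooth ?height_ge0. Qed.

Lemma mdist_tooth_same x s t : 0 <= s -> 0 <= t ->
  mdist (tooth x s) (tooth x t) = `|s - t|.
Proof. by move=> s0 t0; rewrite comb_mdistE eqxx !height_tooth. Qed.

Lemma mdist_tooth_neq x y s t : x != y -> 0 <= s -> 0 <= t ->
  mdist (tooth x s) (tooth y t) = s + mdist x y + t.
Proof. by move=> xy s0 t0; rewrite comb_mdistE ifN// !height_tooth. Qed.

Lemma mdist_tooth0 x y s : 0 <= s ->
  mdist (tooth x s) (tooth y 0) = s + mdist x y.
Proof.
move=> s0; have [<-|xy] := eqVneq x y.
  by rewrite mdist_tooth_same// mdistxx subr0 addr0 ger0_norm.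
by rewrite mdist_tooth_neq// addr0.
Qed.

Lemma foot_nonexpansive (a b : comb T) : mdist (foot a) (foot b) <= mdist a b.
Proof.
rewrite comb_mdistE; case: eqVneq => [->|_]; first by rewrite mdistxx.
have := height_ge0 a; have := height_ge0 b; lra.
Qed.

(* The distance to [tooth x 0], taken positively on the tooth at [x] and
   negatively off it: a nonexpansive function that separates the points of that
   tooth from each other and from the rest of the comb. *)
Definition signed_height (x : T) (a : comb T) : R :=
  if foot a == x then height a else - (mdist x (foot a) + height a).

(** If exactly one point lies on the tooth at [x], equality holds; if neither does, the bound comes
    from that for [mdist x] on the feet. *)
Lemma signed_height_nonexpansive x a b :
  `|signed_height x a - signed_height x b| <= mdist a b.
Proof.
have a0 := height_ge0 a; have b0 := height_ge0 b.
have dab := mdist_ge0 (foot a) (foot b).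
have := mdist_nonexpansive x (foot a) (foot b).
rewrite comb_mdistE /signed_height ler_norml => /andP[d1 d2].
have [ax|ax] := eqVneq (foot a) x; have [bx|bx] := eqVneq (foot b) x.
- by rewrite ax bx eqxx.
- rewrite ifN; last by rewrite ax eq_sym.
  by move: d1 d2; rewrite ax mdistxx ler_norml => *; apply/andP; split; lra.
- rewrite ifN; last by rewrite bx.
  move: d1 d2; rewrite bx mdistxx ler_norml (metric_sym _ x) => *.
  by apply/andP; split; lra.
- have [ab|ab] := eqVneq (foot a) (foot b).
    by rewrite ab -opprD normrN opprD addrACA subrr add0r.
  by rewrite ler_norml; apply/andP; split; lra.
Qed.

Lemma signed_height_ge0 x a : 0 <= signed_height x a ->
  a = tooth x (signed_height x a).
Proof.
rewrite /signed_height; case: eqVneq => [<-|ax]; first by rewrite toothE.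
have := height_ge0 a; move: ax; rewrite eq_sym -mdist_gt0 => *; exfalso; lra.
Qed.

Lemma signed_height_tooth x s : 0 <= s -> signed_height x (tooth x s) = s.
Proof. by move=> s0; rewrite /signed_height eqxx height_tooth. Qed.

Lemma signed_height_lt0 x a : foot a != x -> signed_height x a < 0.
Proof.
move=> ax; rewrite /signed_height ifN//.
have := height_ge0 a; move: ax; rewrite eq_sym -mdist_gt0; lra.
Qed.

End comb_metric.

(** * Geodesics and uniqueness of arcs in the comb *)

Section comb_real_tree.
Variables (R : realType) (T : metricType R).

(** A nonnegative level of [signed_height z] is a single point, so injectivity of [f] gives
    [p = r]. *)
Lemma signed_height_level (f : R -> comb T) z (p q r v : R) :
  {in `[0, 1] &, injective f} -> 0 <= p -> p <= q -> q <= r -> r <= 1 ->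
  0 <= v -> signed_height z (f p) = v -> signed_height z (f r) = v ->
  signed_height z (f q) = v.
Proof.
move=> fI p0 pq qr r1 v0 pv rv; have pr : p = r.
  apply: fI; rewrite ?in_itv/=; [apply/andP; split; lra.. |].
  rewrite (@signed_height_ge0 _ _ z (f p)) ?pv//.
  by rewrite (@signed_height_ge0 _ _ z (f r)) rv.
by rewrite (_ : q = p) //; lra.
Qed.

(** Rising above [v] at [q] would cross the level [v] on both sides of [q], against
    [signed_height_level]. For [v = 0], an arc with neither end above the foot of a tooth never
    climbs that tooth. *)
Lemma signed_height_le_max (f : R -> comb T) z (p q r v : R) :
  {within `[0, 1], continuous f} -> {in `[0, 1] &, injective f} ->
  0 <= p -> p <= q -> q <= r -> r <= 1 -> 0 <= v ->
  signed_height z (f p) <= v -> signed_height z (f r) <= v ->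
  signed_height z (f q) <= v.
Proof.
move=> cf fI p0 pq qr r1 v0 pv rv; rewrite leNgt; apply/negP => vq.
have ivt := path_IVT (v := v) (@signed_height_nonexpansive R T z) cf.
have [||c [pc cq cv]] := ivt _ _ p0 pq; first exact: le_trans r1.
  by rewrite min_l ?max_r ?(le_trans pv (ltW vq))// pv ltW.
have [|c' [qc c'r c'v]] := ivt _ _ (le_trans p0 pq) qr r1.
  by rewrite min_r ?max_l ?(le_trans rv (ltW vq))// rv ltW.
have := signed_height_level fI (le_trans p0 pc) cq qc (le_trans c'r r1) v0 cv c'v.
by move=> fq; move: vq; rewrite fq ltxx.
Qed.

(** As [v] is nonnegative, this also keeps the arc on the tooth at [z], off which [signed_height z]
    is negative. *)
Lemma signed_height_ge_min (f : R -> comb T) z (p q r v : R) :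
  {within `[0, 1], continuous f} -> {in `[0, 1] &, injective f} ->
  0 <= p -> p <= q -> q <= r -> r <= 1 -> 0 <= v ->
  v <= signed_height z (f p) -> v <= signed_height z (f r) ->
  v <= signed_height z (f q).
Proof.
move=> cf fI p0 pq qr r1 v0 pv rv; rewrite leNgt; apply/negP => vq.
have ivt := path_IVT (v := v) (@signed_height_nonexpansive R T z) cf.
have [||c [pc cq cv]] := ivt _ _ p0 pq; first exact: le_trans r1.
  by rewrite min_r ?max_l ?(le_trans (ltW vq) pv)// pv ltW.
have [|c' [qc c'r c'v]] := ivt _ _ (le_trans p0 pq) qr r1.
  by rewrite min_l ?max_r ?(le_trans (ltW vq) rv)// rv ltW.
have := signed_height_level fI (le_trans p0 pc) cq qc (le_trans c'r r1) v0 cv c'v.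
by move=> fq; move: vq; rewrite fq ltxx.
Qed.

Definition tooth_path (x : T) (s t r : R) : comb T :=
  tooth x (if s <= t then s + r else s - r).

Lemma tooth_path_geodesic x s t : 0 <= s -> 0 <= t ->
  geodesic_path (tooth x s) (tooth x t) (tooth_path x s t).
Proof.
move=> s0 t0; rewrite /geodesic_path mdist_tooth_same// /tooth_path.
case: leP => [st|ts].
  rewrite ler0_norm ?subr_le0// opprB; split.
  - move=> r r'; rewrite !in_itv/= => /andP[r0 _] /andP[r'0 _].
    rewrite mdist_tooth_same ?addr_ge0//; congr (`|_|); lra.
  - by rewrite addr0.
  - by rewrite addrCA subrr addr0.
rewrite gtr0_norm ?subr_gt0//; split.
- move=> r r'; rewrite !in_itv/= => /andP[r0 rs] /andP[r'0 r's].
  rewrite mdist_tooth_same; [|lra..].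
  by rewrite distrC; congr (`|_|); lra.
- by rewrite subr0.
- by congr (tooth _ _); lra.
Qed.

(** The two bounds confine the signed height of the arc between [s] and [t]; being nonnegative, it
    determines the point. *)
Lemma arc_in_tooth x s t f : 0 <= s -> 0 <= t ->
  arc_path (tooth x s) (tooth x t) f ->
  f @` `[0, 1] `<=` tooth_path x s t @` `[0, mdist (tooth x s) (tooth x t)].
Proof.
move=> s0 t0 [cf fI f0 f1] q [c /= ]; rewrite in_itv/= => /andP[c0 c1] <-.
have le v := @signed_height_le_max f x 0 c 1 v cf fI (lexx 0) c0 c1 (lexx 1).
have ge v := @signed_height_ge_min f x 0 c 1 v cf fI (lexx 0) c0 c1 (lexx 1).
rewrite f0 f1 !signed_height_tooth// in le ge.
rewrite mdist_tooth_same// /tooth_path; case: leP => [st|/ltW ts].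
  have h1 := le _ t0 st (lexx _); have h2 := ge _ s0 (lexx _) st.
  rewrite (signed_height_ge0 (le_trans s0 h2)).
  exists (signed_height x (f c) - s); last by rewrite addrC subrK.
  by rewrite in_itv/= ler0_norm ?subr_le0//; apply/andP; split; lra.
have h1 := le _ s0 (lexx _) ts; have h2 := ge _ t0 ts (lexx _).
rewrite (signed_height_ge0 (le_trans t0 h2)).
exists (s - signed_height x (f c)); last by congr (tooth _ _); lra.
by rewrite /= in_itv/= ger0_norm ?subr_ge0//; apply/andP; split; lra.
Qed.

Definition comb_path (x y : T) (g : R -> T) (s r : R) : comb T :=
  if r <= s then tooth x (s - r)
  else if r <= s + mdist x y then tooth (g (r - s)) 0
  else tooth y (r - s - mdist x y).

Lemma comb_path_geodesic x y g s t : x != y -> 0 <= s -> 0 <= t ->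
  geodesic_path x y g ->
  geodesic_path (tooth x s) (tooth y t) (comb_path x y g s).
Proof.
move=> xy s0 t0 [iso g0 g1]; have d0 : 0 < mdist x y by rewrite mdist_gt0.
have gx r : 0 <= r -> r <= mdist x y -> mdist x (g r) = r.
  move=> r0 rd; rewrite -[X in mdist X]g0 iso ?in_itv/= ?lexx ?r0 ?(ltW d0)//.
  by rewrite sub0r normrN ger0_norm.
have gy r : 0 <= r -> r <= mdist x y -> mdist y (g r) = mdist x y - r.
  move=> r0 rd; rewrite -[X in mdist X]g1 iso ?in_itv/= ?lexx ?r0 ?(ltW d0)//.
  by rewrite ger0_norm// subr_ge0.
rewrite /geodesic_path mdist_tooth_neq// /comb_path; split.
- move=> r r'; wlog rr' : r r' / r <= r'.
    move=> W rI r'I; have [/W|/ltW r'r] := leP r r'; first exact.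
    by rewrite metric_sym distrC W.
  rewrite !in_itv/= => /andP[r0 rD] /andP[r'0 r'D].
  rewrite distrC (ger0_norm (_ : 0 <= r' - r)) ?subr_ge0//.
  have [rs|sr] := leP r s.
    have [r's|sr'] := leP r' s.
      rewrite mdist_tooth_same ?subr_ge0// ger0_norm; lra.
    have [r'd|dr'] := leP r' (s + mdist x y).
      rewrite mdist_tooth0 ?subr_ge0// gx; lra.
    rewrite mdist_tooth_neq ?subr_ge0//; lra.
  rewrite (lt_geF (lt_le_trans sr rr')).
  have [r'd|dr'] := leP r' (s + mdist x y).
    rewrite (le_trans rr' r'd) mdist_tooth0// add0r iso ?in_itv/=.
    + rewrite distrC ger0_norm; lra.
    + apply/andP; split; lra.
    + apply/andP; split; lra.
  have [rd|dr] := leP r (s + mdist x y).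
    rewrite metric_sym mdist_tooth0; [rewrite gy; lra | lra].
  rewrite mdist_tooth_same; [|lra..].
  rewrite distrC ger0_norm; lra.
- by rewrite s0 subr0.
- rewrite ifN; last by rewrite -ltNge; lra.
  case: leP => [h|h]; last by congr (tooth _ _); lra.
  have -> : t = 0 by lra.
  by rewrite addr0 addrAC subrr add0r g1.
Qed.

(** On the two end teeth the arc stays no higher than its endpoints. Any other point of it lies
    between passages through the two feet, where the arc runs in the base and [gM] applies. *)
Lemma arc_between_teeth x y g s t f : x != y -> 0 <= s -> 0 <= t ->
  geodesic_path x y g ->
  (forall h, arc_path x y h -> h @` `[0, 1] `<=` g @` `[0, mdist x y]) ->
  arc_path (tooth x s) (tooth y t) f ->
  f @` `[0, 1] `<=` comb_path x y g s @` `[0, mdist (tooth x s) (tooth y t)].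
Proof.
move=> xy s0 t0 [_ g0 g1] gM [cf fI f0 f1] q [c /= ].
have d0 : 0 < mdist x y by rewrite mdist_gt0.
rewrite in_itv/= => /andP[c0 c1] <-; rewrite mdist_tooth_neq//.
have le z v := @signed_height_le_max f z 0 c 1 v cf fI (lexx 0) c0 c1 (lexx 1).
have h0 := height_ge0 (f c); rewrite f0 f1 in le.
have [fx|fx] := eqVneq (foot (f c)) x.
  have hs : height (f c) <= s.
    have := le x s s0; rewrite signed_height_tooth// {2}/signed_height fx eqxx.
    apply=> //; apply: ltW (lt_le_trans _ s0); apply: signed_height_lt0.
    by rewrite eq_sym.
  exists (s - height (f c)); first by rewrite /= in_itv/=; apply/andP; split; lra.
  rewrite /comb_path ifT; last by lra.
  by rewrite -[RHS]toothE fx; congr (tooth _ _); lra.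
have [fy|fy] := eqVneq (foot (f c)) y.
  have ht : height (f c) <= t.
    have := le y t t0; rewrite signed_height_tooth// /signed_height fy eqxx.
    apply=> //; apply: ltW (lt_le_trans _ t0); exact: signed_height_lt0.
  exists (s + mdist x y + height (f c)).
    by rewrite /= in_itv/=; apply/andP; split; lra.
  rewrite /comb_path ifN; last by rewrite -ltNge; lra.
  (* At height 0 the parameter is exactly [s + mdist x y], which [comb_path] assigns to the base. *)
  rewrite -[RHS]toothE fy; case: leP => [h|h]; last by congr (tooth _ _); lra.
  have -> : height (f c) = 0 by lra.
  by congr (tooth _ _); rewrite addr0 addrAC subrr add0r g1.
(* The signed height at [x] is [s] at time 0 and negative at [c], so the arc meets [tooth x 0] in
   between; likewise [tooth y 0] after [c]. *)
have [|a [a0 ac fa]] := path_IVT (v := 0) (@signed_height_nonexpansive R T x)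
    cf (lexx 0) c0 c1.
  rewrite f0 signed_height_tooth// ge_min le_max s0 /=.
  by rewrite andbT (ltW (signed_height_lt0 fx)) orbT.
have [|b [cb b1 fb]] := path_IVT (v := 0) (@signed_height_nonexpansive R T y)
    cf c0 c1 (lexx 1).
  rewrite f1 signed_height_tooth// ge_min le_max t0 /= orbT andbT.
  by rewrite (ltW (signed_height_lt0 fy)).
have {}fa : f a = tooth x 0 by rewrite (@signed_height_ge0 _ _ x (f a)) fa.
have {}fb : f b = tooth y 0 by rewrite (@signed_height_ge0 _ _ y (f b)) fb.
have {}ac : a < c.
  by rewrite lt_neqAle ac andbT; apply: contra_neq fx => <-; rewrite fa.
have {}cb : c < b.
  by rewrite lt_neqAle cb andbT; apply: contra_neq fy => ->; rewrite fb.
have shle0 z w : signed_height z (tooth w 0) <= 0.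
  rewrite /signed_height height_tooth// addr0; case: ifP => // _.
  by rewrite oppr_le0 mdist_ge0.
(* Relative to the tooth that carries [f u], both [f a] and [f b] have signed height at most 0,
   hence so has [f u]. *)
have fh0 u : a <= u -> u <= b -> height (f u) = 0.
  move=> au ub; apply/eqP; rewrite eq_le height_ge0 andbT.
  have := @signed_height_le_max f (foot (f u)) a u b 0 cf fI a0 au ub b1 (lexx 0).
  by rewrite fa fb {3}/signed_height eqxx; apply.
have sub01 : `[a, b]%classic `<=` `[0, 1]%classic.
  by move=> u /=; rewrite !in_itv/= => /andP[? ?]; apply/andP; split; lra.
(* Since heights vanish on [[a, b]], taking feet there loses nothing and yields an arc from [x] to
   [y] in the base. *)
have [||w] := gM (fun u => foot (f (a + u * (b - a)))) _ (foot (f c)).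
- have -> : x = foot (f a) by rewrite fa.
  have -> : y = foot (f b) by rewrite fb.
  apply: (@sub_arc_path R T (@foot R T \o f)) => //; first exact: lt_trans cb.
    apply: within_continuous_nonexpansive (@foot_nonexpansive R T) _.
    exact: continuous_subspaceW cf.
  move=> u v ui vi fuv; apply: fI; [exact: sub01|exact: sub01|].
  apply: combP => //; move: ui vi; rewrite !in_itv/= => /andP[? ?] /andP[? ?].
  by rewrite !fh0.
- exists ((c - a) / (b - a)).
    rewrite /= in_itv/= divr_ge0 ?ler_pdivrMr; lra.
  by rewrite divfK ?subr_eq0 ?gt_eqF ?(lt_trans ac)// addrC subrK.
rewrite /= in_itv/= => /andP[w0 wd] gw.
exists (s + w); first by rewrite /= in_itv/=; apply/andP; split; lra.
rewrite -[RHS]toothE fh0 ?ltW// -gw /comb_path.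
case: leP => [h|h].
  have -> : w = 0 by lra.
  by rewrite addr0 subrr g0.
by rewrite ifT; [congr (tooth (g _) _); lra|lra].
Qed.

Lemma comb_real_tree : real_tree T -> real_tree (comb T).
Proof.
move=> /real_treeP TT; apply/real_treeP => p q _.
have p0 := height_ge0 p; have q0 := height_ge0 q.
rewrite -(toothE p) -(toothE q); have [<-|pq] := eqVneq (foot p) (foot q).
  exists (tooth_path (foot p) (height p) (height q)).
    exact: tooth_path_geodesic.
  by move=> f; apply: arc_in_tooth.
have [g gP gM] := TT _ _ pq.
exists (comb_path (foot p) (foot q) g (height p)).
  exact: comb_path_geodesic.
by move=> f; apply: arc_between_teeth.
Qed.

End comb_real_tree.

(** * The two directions of the equivalence *)

Lemma drawing_NSI (R : realType) (V : finType) (S : signed_graph V)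
    (T : metricType R) (D : V -> T) :
  complete_signed S -> real_tree T -> valid_distance_drawing S D ->
  NSI_graph R (positive_subgraph S).
Proof.
move=> S_complete TT [DI DP]; exists T; split => //.
(* The default 0 covers vertices without positive neighbours; [rneg] stays strict there because [D]
   is injective. *)
pose r u := (\big[Num.max/0]_(v | pos S u v) mdist (D u) (D v)) / 2.
have r0 u : 0 <= r u by rewrite divr_ge0// bigmax_ge_id.
have rpos u v : pos S u v -> mdist (D u) (D v) <= 2 * r u.
  move=> uv; rewrite mulrC divfK ?pnatr_eq0//.
  exact: (le_bigmax_cond _ (fun v => mdist (D u) (D v)) uv).
have rneg u v : u != v -> neg S u v -> 2 * r u < mdist (D u) (D v).
  move=> uv nuv; rewrite mulrC divfK ?pnatr_eq0//; apply/bigmax_ltP; split.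
    by rewrite mdist_gt0; apply: contra_neq uv; apply: DI.
  by move=> w uw; apply: DP.
exists D, r; split => // u v uv; rewrite cball_meetP// /=.
split=> [puv|duv].
  have := rpos u v puv; have := rpos v u; rewrite pos_sym puv metric_sym => /(_ isT).
  lra.
(* A negative edge would give [r u + r v < mdist (D u) (D v)], by averaging the bounds at both
   ends. *)
have /orP[//|nuv] := S_complete _ _ uv.
have := rneg u v uv nuv; have := rneg v u; rewrite eq_sym neg_sym uv nuv metric_sym.
by move=> /(_ isT isT) => *; exfalso; lra.
Qed.

(* Growing a segment of length [M - r v] at [c v] turns [d (c u) (c v)] into
   [d (c u) (c v) + 2 M - (r u + r v)], which is at most [2 M] exactly when the
   balls meet. The segments must be distinct even for equal centers: the first
   comb separates the centers, with radii enlarged accordingly, and the second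
   one carries the segments. *)
Lemma NSI_drawing (R : realType) (V : finType) (S : signed_graph V) :
  NSI_graph R (positive_subgraph S) ->
  exists T : metricType R, real_tree T /\
    exists D : V -> T, valid_distance_drawing S D.
Proof.
move=> [T [TT [c [r [r0 cr]]]]].
pose k (v : V) : R := (enum_rank v)%:R.
have k0 v : 0 <= k v by rewrite ler0n.
have kI : injective k.
  by move=> u v /eqP; rewrite eqr_nat => /eqP/val_inj/enum_rank_inj.
pose M := \sum_v (r v + k v).
have rkM v : r v + k v <= M.
  by rewrite /M (bigD1 v)//= lerDl sumr_ge0// => w _; rewrite addr_ge0.
(* Raising the center by [k v] while enlarging the radius by [k v] leaves unchanged whether balls
   with distinct centers meet. *)
pose D v : comb (comb T) := tooth (tooth (c v) (k v)) (M - (r v + k v)).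
have DE u v : u != v -> mdist (D u) (D v) =
    M - (r u + k u) + mdist (tooth (c u) (k u)) (tooth (c v) (k v)) +
    (M - (r v + k v)).
  move=> uv; rewrite [LHS]mdist_tooth_neq ?subr_ge0 ?rkM//; apply: contra_neq uv => cuv.
  by apply: kI; rewrite -(height_tooth (c u) (k0 u)) cuv height_tooth.
have DI : injective D.
  move=> u v /(congr1 (fun a => height (foot a))).
  by rewrite /= !height_tooth// => /kI.
have adjP u v : u != v -> pos S u v <-> mdist (D u) (D v) <= 2 * M.
  move=> uv; rewrite DE//.
  (* For equal centers both sides hold: the balls share their center, and the absolute value of
     [k u - k v] is at most [k u + k v]. *)
  have [cuv|cuv] := eqVneq (c u) (c v).
    rewrite cuv mdist_tooth_same//; split=> _.
      have := r0 u; have := r0 v; have := k0 u; have := k0 v.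
      case: (ger0P (k u - k v)) => *; lra.
    apply/(cr u v uv); exists (c u).
    by rewrite /cball/= cuv mdistxx !r0.
  rewrite mdist_tooth_neq// (cr u v uv) cball_meetP//.
  by split; lra.
exists (comb (comb T)); split; first exact/comb_real_tree/comb_real_tree.
exists D; split => // u v w puv nuw.
have uv : u != v by apply/eqP => uv; move: puv; rewrite uv pos_irr.
have uw : u != w by apply/eqP => uw; move: nuw; rewrite uw neg_irr.
apply: (@le_lt_trans _ _ (2 * M)); first exact/adjP.
rewrite ltNge; apply/negP => /(adjP _ _ uw) puw.
by move: (pos_neg_disjoint S u w); rewrite puw nuw.
Qed.

Theorem theorem2 (R : realType) (V : finType) (S : signed_graph V)
    (S_complete : complete_signed S) :
  (exists T : metricType R, real_tree T /\
     exists D : V -> T, valid_distance_drawing S D)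
  <-> NSI_graph R (positive_subgraph S).
Proof.
split; last exact: NSI_drawing.
by move=> [T [TT [D DP]]]; apply: drawing_NSI DP.
Qed.
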